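(* Let $X$ be a Banach space over $\mathbb{F}$ ($\mathbb{F}=\mathbb{R}$ or $\mathbb{C}$) for which the numerical radius $w(\cdot)$ is a norm on $\mathcal{L}(X)$. Let $\mathcal{V}$ be an $n$-dimensional subspace of $\mathcal{L}(X)_w$ and $T\in\mathcal{L}(X)_w$. Then $T\perp_w\mathcal{V}$ if and only if the following are true. (i) There exist scalars $t_1,t_2,\ldots,t_h>0$ ($h\leq n+1$ if $\mathbb{F}=\mathbb{R}$ and $h\leq 2n+1$ if $\mathbb{F}=\mathbb{C}$) such that $\sum_{i=1}^h t_i=1$. (ii) For these scalars and for each $1\leq i\leq h$, there exists a net $\{x_{i\alpha}^*\otimes x_{i\alpha}\}_\alpha$ in $\mathcal{A}$ such that $$\lim_{\alpha}x^*_{i\alpha}(Tx_{i\alpha})=w(T)\quad\text{for each } 1\le i\le h,\qquad\text{and}\qquad \sum_{i=1}^h t_i\lim_{\alpha}x^*_{i\alpha}(Sx_{i\alpha})=0\ \text{ for all } S\in\mathcal{V}$$ (in particular all these limits exist).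
   Context: For a Banach space $X$ over $\mathbb{F}\in\{\mathbb{R},\mathbb{C}\}$, $X^*$ is its dual, $S_X$ its unit sphere, $B_X$ its closed unit ball. $\mathcal{L}(X)$ is the space of bounded linear operators on $X$. The numerical radius of $T\in\mathcal{L}(X)$ is $w(T)=\sup\{|x^*(Tx)| : x^*\in S_{X^*},\ x\in S_X,\ x^*(x)=1\}$; only spaces $X$ for which $w(\cdot)$ is a norm on $\mathcal{L}(X)$ are considered. $\mathcal{L}(X)_w$ denotes $\mathcal{L}(X)$ with the norm $w(\cdot)$, and $\mathcal{L}(X)_w^*$ is its dual. For $x\in X$, $x^*\in X^*$, $x^*\otimes x$ is the linear functional on $\mathcal{L}(X)_w$ given by $(x^*\otimes x)(T)=x^*(Tx)$. Put $$\mathcal{A}=\{x^*\otimes x\in\mathcal{L}(X)_w^* : x^*\in B_{X^*},\ x\in B_X,\ |x^*(x)|=\|x^*\|\|x\|\}.$$ For $T,A\in\mathcal{L}(X)_w$, $T\perp_w A$ means $w(T+\lambda A)\geq w(T)$ for all scalars $\lambda\in\mathbb{F}$; for a subspace $\mathcal{V}$, $T\perp_w\mathcal{V}$ means $T\perp_w A$ for all $A\in\mathcal{V}$. *)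

(* Defs.v *)
From HB Require Import structures.
From mathcomp Require Import all_boot all_order all_algebra.
From mathcomp Require Import complex.
From mathcomp Require Import boolp classical_sets functions reals.
From mathcomp Require Import topology normedtype.

Set Implicit Arguments.
Unset Strict Implicit.
Unset Printing Implicit Defensive.

Import Order.TTheory GRing.Theory Num.Theory.
Import numFieldNormedType.Exports.

Local Open Scope classical_set_scope.
Local Open Scope ring_scope.

Variant scalars := RealScalars | ComplexScalars.

Definition scalar_field (R : realType) (s : scalars) : numFieldType :=
  match s with
  | RealScalars => R
  | ComplexScalars => R[i]
  end.

Section BoundedLinearMaps.
Context {K : numFieldType} (E G : normedModType K).

Definition bounded_linear : {pred E -> G} :=
  mem [set f : E -> G | linear f /\ exists M : K, forall x, `|f x| <= M * `|x|].

Lemma bounded_linear_submod_closed : submod_closed bounded_linear.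
Proof.
split.
  rewrite inE; split; first by move=> a u v; rewrite /= scaler0 addr0.
  by exists 0 => x; rewrite mul0r normr_le0.
move=> a f g; rewrite !inE => -[lf [M Mf]] [lg [N Ng]]; split.
  move=> b u v; rewrite !fctE lf lg !scalerDr !scalerA mulrC.
  by rewrite addrACA.
exists (`|a| * M + N) => x; rewrite !fctE mulrDl (le_trans (ler_normD _ _))//.
by rewrite lerD// normrZ -mulrA ler_wpM2l.
Qed.

HB.instance Definition _ :=
  GRing.isSubmodClosed.Build K (E -> G) bounded_linear
    bounded_linear_submod_closed.

Record blinear := BLinear
  { blinear_fun :> E -> G; blinearP : blinear_fun \in bounded_linear }.

HB.instance Definition _ := [isSub for blinear_fun].
HB.instance Definition _ := [Choice of blinear by <:].
HB.instance Definition _ := [SubChoice_isSubZmodule of blinear by <:].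
HB.instance Definition _ := [SubZmodule_isSubLmodule of blinear by <:].

End BoundedLinearMaps.

(** Norms take their values in [K], as everywhere in the library.  The order of
    [R[i]] is partial ([x <= y] iff [y - x] is a nonnegative real), and in it the
    least upper bound of a nonempty bounded set of nonnegative reals is its real
    supremum; hence [supremum], with value [0] on the empty set. *)
Section NumericalRadius.
Context {K : numFieldType} {X : normedModType K}.

Local Notation "'L(X)'" := (blinear X X).
Local Notation "'X^*'" := (blinear X K^o).

Definition dual_norm (f : X^*) : K :=
  supremum 0 [set `|f x| | x in [set x : X | `|x| <= 1]].

Definition numerical_radius (T : L(X)) : K :=
  supremum 0 [set r : K | exists (f : X^*) (x : X),
    [/\ dual_norm f = 1, `|x| = 1, f x = 1 & r = `|f (T x)|]].

Local Notation w := numerical_radius.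

Definition numerical_radius_is_norm : Prop :=
  [/\ forall T : L(X), 0 <= w T,
      forall T : L(X), w T = 0 -> T = 0,
      forall (a : K) (T : L(X)), w (a *: T) = `|a| * w T &
      forall T S : L(X), w (T + S) <= w T + w S].

(** The dual of L(X) normed by the numerical radius. *)
Definition dual_w : set (L(X) -> K^o) :=
  [set phi | linear phi /\ exists M : K, forall T, `|phi T| <= M * w T].

Definition tensor (f : X^*) (x : X) : L(X) -> K^o := fun T => f (T x).

Definition calA : set (L(X) -> K^o) :=
  [set phi | dual_w phi /\ exists (f : X^*) (x : X),
    [/\ phi = tensor f x, dual_norm f <= 1, `|x| <= 1 &
        `|f x| = dual_norm f * `|x|]].

Definition orth_w (T A : L(X)) : Prop := forall l : K, w T <= w (T + l *: A).

Definition orth_w_subspace (T : L(X)) (V : set L(X)) : Prop :=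
  forall A, V A -> orth_w T A.

End NumericalRadius.

Definition subspace_of_dim {K : numFieldType} {E : lmodType K} (n : nat)
    (V : set E) : Prop :=
  exists b : 'I_n -> E,
    (forall c : 'I_n -> K, \sum_i c i *: b i = 0 -> forall i, c i = 0) /\
    V = [set \sum_i c i *: b i | c in [set: 'I_n -> K]].

Record net (T : Type) := Net {
  net_index : Type;
  net_le : net_index -> net_index -> Prop;
  net_inhabited : inhabited net_index;
  net_refl : forall a, net_le a a;
  net_trans : forall a b c, net_le a b -> net_le b c -> net_le a c;
  net_directed : forall a b, exists c, net_le a c /\ net_le b c;
  net_val :> net_index -> T }.

(** Convergence of a net is convergence along the filter of its tails. *)
Definition tails (T : Type) (x : net T) : set_system (net_index x) :=
  [set P | exists a, forall b, net_le a b -> P b].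
Arguments tails {T} x.

Lemma tails_properfilter (T : Type) (x : net T) : ProperFilter (tails x).
Proof.
have [a0] := net_inhabited x.
apply: Build_ProperFilter_ex => [P [a aP]|].
  by exists a; apply: aP; exact: net_refl.
split; first by exists a0.
  move=> P Q [a aP] [b bQ]; have [c [ac bc]] := net_directed a b.
  by exists c => d cd; split; [apply: aP|apply: bQ]; exact: net_trans cd.
by move=> P Q PQ [a aP]; exists a => b ab; apply/PQ/aP.
Qed.

#[export] Existing Instance tails_properfilter.

Definition max_terms (s : scalars) (n : nat) : nat :=
  match s with
  | RealScalars => n.+1
  | ComplexScalars => n.*2.+1
  end.

(* Main.v *)
Require Import Defs.
From mathcomp Require Import all_boot all_order all_algebra.
From mathcomp Require Import complex.
From mathcomp Require Import boolp classical_sets functions reals.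
From mathcomp Require Import topology normedtype.
From mathcomp Require Import sequences interval_inference.
From mathcomp Require Import ring lra.

(** Let [b] be a basis of V and let C be the set of all points
    (Re f(T x), f(b_1 x), ..., f(b_n x)) with f (x) x in calA, the last n entries
    being read in real coordinates.  Orthogonality says that every functional
    (a, q) |-> a + <c, q> has supremum at least w(T) on C, whereas a <= w(T) on C.
    Hence no hyperplane strictly separates (w(T), 0) from C, and (w(T), 0) is a
    convex combination of points of the closure of C; all of them lie on the face
    a = w(T).  Caratheodory's theorem in the space of the q alone bounds their
    number by 1 plus the real dimension of K^n, and each of them is the limit of
    a sequence in C.  Conversely, averaging the limits gives w(T) <= w(T + l A). *)

Set Implicit Arguments.
Unset Strict Implicit.
Unset Printing Implicit Defensive.

Import Order.TTheory GRing.Theory Num.Theory.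
Import numFieldNormedType.Exports.

Local Open Scope ring_scope.

(** * Convex hulls in finite-dimensional real spaces *)

(** The matrix of the points indexed by [A] has more rows than columns, so its left kernel is
    nonzero; a kernel vector, extended by zero off [A], is [mu]. *)
Lemma linear_dependence (R : fieldType) (F J : finType) (p : F -> J -> R)
    (A : {set F}) : (#|J| < #|A|)%N ->
  exists mu : F -> R,
    [/\ exists f, mu f != 0, forall f, f \notin A -> mu f = 0 &
        forall j, \sum_f mu f * p f j = 0].
Proof.
move=> JA.
pose M := \matrix_(i < #|A|, j < #|J|) p (enum_val i) (enum_val j).
have /rowV0Pn[v /sub_kermxP vM vN0] : kermx M != 0.
  rewrite -mxrank_eq0 mxrank_ker subn_eq0 -ltnNge.
  by rewrite (leq_ltn_trans (rank_leq_col M)).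
have /card_gt0P[a0 Aa0] : (0 < #|A|)%N by exact: leq_ltn_trans JA.
pose rk := enum_rank_in Aa0.
exists (fun f => if f \in A then v 0 (rk f) else 0); split.
- have /rV0Pn[i vi] := vN0.
  by exists (enum_val i); rewrite enum_valP /rk enum_valK_in.
- by move=> f /negbTE ->.
- move=> j; rewrite (bigID (mem A)) /= [X in _ + X]big1 ?addr0; last first.
    by move=> f /negbTE ->; rewrite mul0r.
  rewrite big_enum_val; have /rowP/(_ (enum_rank j)) := vM.
  rewrite !mxE => vMj; rewrite -[RHS]vMj; apply: eq_bigr => i _.
  by rewrite enum_valP /rk enum_valK_in !mxE enum_rankK.
Qed.

Definition weights (R : numDomainType) (F : finType) (t : F -> R) : Prop :=
  (forall f, 0 <= t f) /\ \sum_f t f = 1.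

(** Induction on the size of the support: an affine dependence among more than [#|J|.+1] points
    allows one weight to be moved to zero. That the support of [t'] lies in that of [t] later keeps
    the points on a face. *)
Lemma caratheodory (R : realFieldType) (F J : finType) (p : F -> J -> R)
    (t : F -> R) : weights t ->
  exists t' : F -> R,
    [/\ weights t', (#|[set f | t' f != 0%R]| <= #|J|.+1)%N,
        forall f, t' f != 0 -> t f != 0 &
        forall j, \sum_f t' f * p f j = \sum_f t f * p f j].
Proof.
have [k] := ubnP #|[set f | t f != 0]|.
elim: k t => // k IH t; rewrite ltnS => tk wt.
have [small|big] := leqP #|[set f | t f != 0]| #|J|.+1; first by exists t.
(* The coordinate [None] turns linear dependence into affine dependence. *)
pose p' f (j : option J) := if j is Some j then p f j else 1.
have [|mu0 [[f0 mu0f0] mu0A mu0p]] :=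
  @linear_dependence R F (option J) p' [set f | t f != 0].
  by rewrite card_option.
have [mu [[f1 muf1] muA mup]] : exists mu : F -> R,
    [/\ exists f, 0 < mu f, forall f, t f = 0 -> mu f = 0 &
        forall j, \sum_f mu f * p' f j = 0].
  have mu0A' f : t f = 0 -> mu0 f = 0.
    by move=> tf; apply: mu0A; rewrite inE tf eqxx.
  move: mu0f0; rewrite neq_lt => /orP[mu0f0|mu0f0]; last first.
    by exists mu0; split=> //; exists f0.
  exists (fun f => - mu0 f); split.
  - by exists f0; rewrite oppr_gt0.
  - by move=> f /mu0A' ->; rewrite oppr0.
  - move=> j; under eq_bigr do rewrite mulNr.
    by rewrite sumrN mu0p oppr0.
(* The least ratio over positive [mu f] is the largest multiple of [mu] that can be subtracted from
   [t] with weights still nonnegative; the weight at [f2] then vanishes. *)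
pose r f := t f / mu f.
have [f2 /= muf2 f2min] := @arg_minP _ R F f1 (fun f => 0 < mu f) r muf1.
pose t1 f := t f - r f2 * mu f.
have [t0 t_sum] := wt.
have r0 : 0 <= r f2 by rewrite divr_ge0// ltW.
have t1p (j : option J) : \sum_f t1 f * p' f j = \sum_f t f * p' f j.
  under eq_bigr do rewrite mulrBl -mulrA.
  by rewrite sumrB -mulr_sumr mup mulr0 subr0.
have wt1 : weights t1.
  split=> [f|].
    rewrite subr_ge0; have [muf|muf] := ltP 0 (mu f).
      by rewrite -ler_pdivlMr// f2min.
    by rewrite (le_trans _ (t0 f))// mulr_ge0_le0.
  have := t1p None; under eq_bigr do rewrite mulr1.
  by under [X in _ = X -> _]eq_bigr do rewrite mulr1; move=> ->.
have t1t f : t1 f != 0 -> t f != 0.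
  by apply: contra_neq => tf; rewrite /t1 tf muA// mulr0 subr0.
have [|t' [wt' t'J t't1 t'p]] := IH t1 _ wt1.
  apply: leq_trans tk; apply: proper_card; apply/properP; split.
    by apply/fintype.subsetP => f; rewrite !inE; exact: t1t.
  exists f2; rewrite !inE; last by rewrite /t1 /r divfK ?subrr ?eqxx// gt_eqF.
  by apply: contraTneq muf2 => /muA ->; rewrite ltxx.
exists t'; split=> //; first by move=> f /t't1/t1t.
by move=> j; rewrite t'p; have := t1p (Some j).
Qed.

Definition convex_comb (R : numDomainType) (J : finType) (C : set (J -> R))
    (N : finType) (t : N -> R) (p : N -> J -> R) (z : J -> R) : Prop :=
  [/\ weights t, forall i, C (p i) & forall j, z j = \sum_i t i * p i j].

Definition convex_hull (R : numDomainType) (J : finType) (C : set (J -> R))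
    : set (J -> R) :=
  [set z | exists (N : finType) t p, @convex_comb R J C N t p z]%classic.

(** The support is enumerated and padded with zero weights to exactly [#|J|.+1] terms; as this index
    set does not depend on [z], limits can be taken term by term. *)
Lemma caratheodory_hull (R : realFieldType) (J : finType) (C : set (J -> R)) z :
  convex_hull C z -> exists t p, @convex_comb R J C 'I_(#|J|.+1) t p z.
Proof.
move=> [N [t [p [wt Cp zE]]]].
have [t' [wt' suppt' _ t'p]] := caratheodory p wt.
have [i0 t'i0] : exists i, t' i != 0.
  have : \sum_i t' i != 0 by rewrite wt'.2 oner_neq0.
  apply: contra_neqP => /forallNP t'0; apply: big1 => i _.
  by apply/eqP/negPn/negP; exact: t'0.
pose s := enum [set i | t' i != 0%R].
have sz : (size s <= #|J|.+1)%N by rewrite -cardE.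
(* Past the end of [s], [nth] returns [i0], whose point still lies in [C]. *)
pose u k := if (k < size s)%N then t' (nth i0 s k) else 0.
have sumE (g : N -> R) :
    \sum_(i < #|J|.+1) u i * g (nth i0 s i) = \sum_i t' i * g i.
  transitivity (\sum_(0 <= i < #|J|.+1) u i * g (nth i0 s i)).
    by rewrite big_mkord.
  rewrite (@big_cat_nat _ _ _ (size s))//= [X in _ + X]big_nat_cond.
  rewrite [X in _ + X]big1 ?addr0.
    rewrite -[RHS](big_rmcond (fun i => i \in s)) => [|i]; last first.
      by rewrite mem_enum inE negbK => /eqP ->; rewrite mul0r.
    rewrite -big_uniq ?enum_uniq//= [RHS](big_nth i0).
    by apply: eq_big_nat => i /= ilt; rewrite /u ilt.
  by move=> i /andP[/andP[si _] _]; rewrite /u ltnNge si mul0r.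
exists (fun i : 'I_(#|J|.+1) => u i).
exists (fun i : 'I_(#|J|.+1) => p (nth i0 s i)); split=> //.
  split=> [i|]; first by rewrite /u; case: ifP => // _; exact: wt'.1.
  have := sumE (fun=> 1); under eq_bigr do rewrite mulr1.
  by under [X in _ = X -> _]eq_bigr do rewrite mulr1; rewrite wt'.2.
by move=> j; rewrite zE -t'p -(sumE (fun i => p i j)).
Qed.

Lemma hull_segment (R : numDomainType) (J : finType) (C : set (J -> R)) z q s :
  convex_hull C z -> C q -> 0 <= s <= 1 ->
  convex_hull C (fun j => (1 - s) * z j + s * q j).
Proof.
move=> [N [t [p [[t0 t1] Cp zE]]]] Cq /andP[s0 s1].
exists (N + unit)%type.
exists (fun x => if x is inl i then (1 - s) * t i else s).
exists (fun x => if x is inl i then p i else q); split.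
- split=> [[i|_]//|]; first by rewrite mulr_ge0// subr_ge0.
  by rewrite big_sumType/= -mulr_sumr t1 mulr1 big_const card_unit/= addr0 subrK.
- by case.
- move=> j; rewrite big_sumType/= zE mulr_sumr big_const card_unit/= addr0.
  by congr (_ + _); apply: eq_bigr => i _; rewrite mulrA.
Qed.

Local Open Scope classical_set_scope.
Local Open Scope ring_scope.

(* The separating functional is a point of the hull whose norm is almost minimal. *)
Lemma separation (R : realType) (J : finType) (C : set (J -> R)) (B d : R) :
  0 < d -> C !=set0 -> (forall p, C p -> \sum_j p j ^+ 2 <= B) ->
  (forall z, convex_hull C z -> d <= \sum_j z j ^+ 2) ->
  exists (c : J -> R) (e : R),
    0 < e /\ forall p, C p -> e <= \sum_j c j * p j.
Proof.
move=> d0 [q0 Cq0] CB far.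
pose sq (z : J -> R) := \sum_j z j ^+ 2.
have hullC p : C p -> convex_hull C p.
  move=> Cp; exists unit, (fun=> 1), (fun=> p); split=> //.
    by split=> [_|]; rewrite ?ler01// big_const card_unit/= addr0.
  by move=> j; rewrite big_const card_unit/= addr0 mul1r.
pose S := [set sq z | z in convex_hull C].
have infS : has_inf S.
  split; first by exists (sq q0), q0 => //; exact: hullC.
  by exists d => _ [z hz <-]; exact: far.
pose dd := inf S.
have ddz z : convex_hull C z -> dd <= sq z.
  by move=> hz; apply: ge_inf; [exact: infS.2|exists z].
have dd0 : 0 < dd.
  apply: (lt_le_trans d0); apply: lb_le_inf; first exact: infS.1.
  by move=> _ [z hz <-]; exact: far.
have ddB : dd <= B by rewrite (le_trans (ddz _ (hullC _ Cq0)))// CB.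
have B0 : 0 < B by exact: lt_le_trans ddB.
(* Moving from [z] towards [q] by the fraction [s] keeps the quadratic term [s ^+ 2 * sq q] below
   [s * dd / 4], up to equality. *)
pose s := dd / (4 * B).
have sB : s * B = dd / 4 by rewrite /s; field; rewrite gt_eqF.
have s0 : 0 < s by rewrite divr_gt0// mulr_gt0.
have s1 : s <= 1 / 4 by rewrite ler_pdivrMr ?mulr_gt0//; lra.
have [_ [z hz <-] zdd] : exists2 y, S y & y < dd + s * dd / 2.
  by apply: inf_adherent => //; nra.
exists z, (dd / 2); split; first by lra.
move=> q Cq; set zq := \sum_j _.
have : dd <= (1 - s) ^+ 2 * sq z + 2 * s * (1 - s) * zq + s ^+ 2 * sq q.
  have s01 : 0 <= s <= 1 by apply/andP; split; lra.
  rewrite (le_trans (ddz _ (hull_segment hz Cq s01)))//.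
  rewrite /sq /zq !mulr_sumr -!big_split/= le_eqVlt; apply/orP; left; apply/eqP.
  by apply: eq_bigr => j _; ring.
have : sq q <= B by exact: CB.
move: zdd; set Z := sq z; set Q := sq q => zdd QB.
apply: contraTT; rewrite -!ltNge => zqdd.
(* If [zq < dd / 2], the three terms add up to less than [dd - s * dd / 4], although the moved point
   lies in the hull. *)
have h1 : (1 - s) ^+ 2 * Z <= dd * (1 - s) ^+ 2 + s * dd / 2.
  have : (1 - s) ^+ 2 * Z <= (1 - s) ^+ 2 * (dd + s * dd / 2).
    by rewrite ler_wpM2l ?sqr_ge0// ltW.
  have : (1 - s) ^+ 2 * (s * dd / 2) <= 1 * (s * dd / 2).
    by rewrite ler_wpM2r//; nra.
  by lra.
have h2 : s ^+ 2 * Q <= s * (dd / 4).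
  by rewrite -sB expr2 -mulrA !ler_wpM2l// ltW.
have h3 : s * (1 - s) * (2 * zq) < s * (1 - s) * dd.
  by rewrite ltr_pM2l; [lra|nra].
have h4 : 0 < s * dd by rewrite mulr_gt0.
by nra.
Qed.

(** * Limits of convex combinations along an ultrafilter *)

(** By compactness the image of [U] has a cluster point in [[-M, M]], and an ultrafilter converges
    to each of its cluster points. *)
Lemma ultra_bounded_cvg (R : realType) (T : Type) (U : set_system T)
    (M : R) (u : T -> R) : UltraFilter U -> (forall k, `|u k| <= M) ->
  exists l : R, u @ U --> l.
Proof.
move=> UU uM.
have [|l [_ cl]] := @segment_compact R (- M) M (u @ U) _.
  by apply: (@filterE _ U) => k /=; rewrite in_itv/= -ler_norml.
exists l => A lA; rewrite /nbhs/=.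
have [//|UnA] := in_ultra_setVsetC (u @^-1` A) UU.
by have [y []] := cl (~` A) A UnA lA.
Qed.

Lemma cvg_sum (K : numFieldType) (V : normedModType K) (T : Type)
    (F : set_system T) (I : finType) (f : I -> T -> V) (a : I -> V) :
  Filter F -> (forall i, f i x @[x --> F] --> a i) ->
  \sum_i f i x @[x --> F] --> \sum_i a i.
Proof.
by move=> FF fa; apply: cvg_big => //; exact: add_continuous.
Qed.

(** Hull points approaching 0 are written with [#|J|.+1] terms each; their bounded weights and
    points converge together along an ultrafilter, so 0 is a convex combination of points of the
    closure of [C]. *)
Lemma hull_limit (R : realType) (J : finType) (C : set (J -> R)) (M : R) :
  (forall p j, C p -> `|p j| <= M) ->
  (forall e : R, 0 < e -> exists2 z, convex_hull C z & forall j, `|z j| < e) ->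
  exists (t : 'I_(#|J|.+1) -> R) (q : 'I_(#|J|.+1) -> J -> R),
    [/\ weights t, forall j, \sum_i t i * q i j = 0 &
        forall i (e : R), 0 < e -> exists2 p, C p & forall j, `|p j - q i j| < e].
Proof.
move=> CM hullC0.
have /choice[tp tpP] (k : nat) :
    exists tp : ('I_(#|J|.+1) -> R) * ('I_(#|J|.+1) -> J -> R),
    [/\ weights tp.1, forall i, C (tp.2 i) &
        forall j, `|\sum_i tp.1 i * tp.2 i j| < k.+1%:R^-1].
  have [|z /caratheodory_hull[t [p [wt Cp zE]]] ze] := hullC0 (k.+1%:R^-1).
    by rewrite invr_gt0.
  by exists (t, p); split=> // j /=; rewrite -zE.
(* One ultrafilter finer than [\oo] gives all the limits at once, in place of successive
   subsequences. *)
have [U [UU oU]] := @ultraFilterLemma _ \oo _.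
have /choice[t tP] i : exists l : R, (tp k).1 i @[k --> U] --> l.
  apply: (@ultra_bounded_cvg _ _ _ 1) => k.
  have [[t0 t1] _ _] := tpP k; rewrite ger0_norm// -t1.
  by rewrite (bigD1 i)//= lerDl sumr_ge0.
have /choice[q' q'P] (ij : 'I_(#|J|.+1) * J) :
    exists l : R, (tp k).2 ij.1 ij.2 @[k --> U] --> l.
  by apply: (@ultra_bounded_cvg _ _ _ M) => k; have [_ Cp _] := tpP k; exact: CM.
pose q i j := q' (i, j).
have qP i j : (tp k).2 i j @[k --> U] --> q i j by exact: (q'P (i, j)).
have tP0 k i : 0 <= (tp k).1 i by have [[+ _] _ _] := tpP k; exact.
exists t, q; split.
- split=> [i|].
    by apply: (cvgr_to_ge (tP i)); apply: nearW => k.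
  apply: (cvg_unique _ (cvg_sum _ tP)) => //.
  rewrite (_ : (fun k => _) = cst 1); first exact: cvg_cst.
  by apply/funext => k; have [[_ +] _ _] := tpP k.
- move=> j.
  have s1 : \sum_i (tp k).1 i * (tp k).2 i j @[k --> U] --> \sum_i t i * q i j.
    by apply: cvg_sum => i; apply: cvgM; [exact: tP|exact: qP].
  apply: (cvg_unique _ s1) => //.
  have : \sum_i (tp k).1 i * (tp k).2 i j @[k --> \oo] --> 0.
    apply/cvgr0Pnorm_lt => e e0; have := near_infty_natSinv_lt (PosNum e0).
    by apply: filterS => k; apply: lt_trans; have [_ _] := tpP k.
  by move=> H A /H /oU.
- move=> i e e0.
  have : \forall k \near U, forall j, `|(tp k).2 i j - q i j| < e.
    by apply: filter_forall => j; have /cvgrPdistC_lt := qP i j; exact.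
  move=> /filter_ex[k kP]; exists ((tp k).2 i) => //.
  by have [_ + _] := tpP k; exact.
Qed.

Lemma sum_option (V : nmodType) (I : finType) (F : option I -> V) :
  \sum_j F j = F None + \sum_i F (Some i).
Proof.
rewrite (bigD1 None)//= (reindex_omap Some id)/=; last by case.
by congr (_ + _); apply: eq_bigl => i; rewrite eqxx.
Qed.

(* Caratheodory's theorem is applied twice: in dimension [#|I| + 1], to keep the
   number of terms bounded while passing to the limit, and in dimension [#|I|]
   inside the face [a = w], to get [#|I| + 1] terms instead of [#|I| + 2]. *)
Lemma extreme_convex_comb (R : realType) (I : finType) (C : set (R * (I -> R)))
    (w M : R) :
  (forall a q, C (a, q) -> `|a| <= w) ->
  (forall a q i, C (a, q) -> `|q i| <= M) ->
  (forall (c : I -> R) (e : R), 0 < e ->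
     exists a q, C (a, q) /\ w - e < a + \sum_i c i * q i) ->
  exists (h : nat) (t : 'I_h -> R) (q : 'I_h -> I -> R),
    [/\ (h <= #|I|.+1)%N, forall k, 0 < t k, \sum_k t k = 1,
        forall i, \sum_k t k * q k i = 0 &
        forall k (e : R), 0 < e -> exists a p,
          [/\ C (a, p), w - e < a & forall i, `|p i - q k i| < e]].
Proof.
move=> Cw CM Cc.
(* The coordinate [None] holds [a - w], which is nonpositive on [C]; the target point becomes the
   origin. *)
pose lift (a : R) (q : I -> R) (j : option I) := if j is Some i then q i else a - w.
pose C' := [set z | exists a q, C (a, q) /\ z = lift a q].
have [a0 [q0 [Ca0 _]]] := Cc (fun=> 0) 1 ltr01.
have w0 : 0 <= w by rewrite (le_trans _ (Cw _ _ Ca0)).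
pose B := w + w + `|M|.
have C'B z j : C' z -> `|z j| <= B.
  move=> [a [q [Caq ->]]]; case: j => [i|] /=.
    rewrite (le_trans (CM _ _ i Caq))// (le_trans (ler_norm M))//.
    by rewrite lerDr addr_ge0.
  rewrite (le_trans (ler_normB _ _))// (ger0_norm w0) /B.
  by rewrite -[leLHS]addr0 !lerD// (Cw _ _ Caq).
have near0 (e : R) : 0 < e ->
    exists2 z, convex_hull C' z & forall j, `|z j| < e.
  (* Otherwise every hull point has a coordinate of modulus at least [e], hence square norm at least
     [e ^+ 2], and some functional [c] is at least some [d > 0] on [C']. *)
  move=> e0; apply: contrapT => /forall2NP far.
  have [||||c [d [d0 cd]]] :=
    @separation R (option I) C' (\sum_(j : option I) B ^+ 2) (e ^+ 2).
  - by rewrite exprn_gt0.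
  - by exists (lift a0 q0), a0, q0.
  - move=> p /C'B pB; apply: ler_sum => j _; rewrite -real_normK ?num_real//.
    by rewrite ler_sqr ?nnegrE ?(le_trans _ (pB j)).
  - move=> z hz; have [//|] := far z => /existsNP[j /negP]; rewrite -leNgt => ez.
    rewrite (bigD1 j)//= -[leLHS]addr0 lerD ?sumr_ge0// => [|i _].
      by rewrite -[leRHS]real_normK ?num_real// ler_sqr ?nnegrE// ltW.
    by rewrite sqr_ge0.
  have cd' a q : C (a, q) -> d <= c None * (a - w) + \sum_i c (Some i) * q i.
    move=> Caq; have := cd (lift a q); rewrite sum_option/=; apply.
    by exists a, q.
  have aw a q : C (a, q) -> a <= w by move=> /Cw/ler_normlW.
  (* Dividing by a negative [c None] bounds a functional with coefficient 1 at [a] by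
     [w + d / c None] on [C], against the hypothesis with [e = - d / c None]. *)
  have [cN|cN] := ltP (c None) 0.
    have [|a [q [Caq]]] := Cc (fun i => c (Some i) / c None) (- d / c None).
      by rewrite -mulrNN -invrN opprK divr_gt0// oppr_gt0.
    apply/negP; rewrite -leNgt; under eq_bigr do rewrite mulrAC mulrC.
    rewrite -mulr_sumr; have := cd' _ _ Caq; set S := \sum_i _ => dS.
    rewrite -subr_ge0 -(nmulr_lle0 _ cN).
    have -> : (w - - d / c None - (a + (c None)^-1 * S)) * c None =
              d - (c None * (a - w) + S) by field; rewrite lt_eqF.
    by rewrite subr_le0.
  (* Here [c None * (a - w) <= 0], so the other coordinates alone contribute at least [d]; as
     [a <= w], the opposite coefficients contradict the hypothesis. *)
  have [a [q [Caq]]] := Cc (fun i => - c (Some i)) d d0.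
  apply/negP; rewrite -leNgt; under eq_bigr do rewrite mulNr.
  rewrite sumrN; have := cd' _ _ Caq.
  have aw0 : a - w <= 0 by rewrite subr_le0 (aw _ _ Caq).
  by have := mulr_ge0_le0 cN aw0; lra.
have [t [q [wt tq0 qC]]] := hull_limit (fun p j => @C'B p j) near0.
have q_le i : q i None <= 0.
  rewrite leNgt; apply/negP => qi; have [_ [a [p [Cap ->]]]] := qC i _ qi.
  move=> /(_ None); rewrite ltr_distl/= subrr => /andP[+ _].
  by rewrite ltNge subr_le0 (le_trans (ler_norm _))// (Cw _ _ Cap).
(* The values [q i None] are nonpositive with weighted mean 0, so they vanish wherever the weight is
   positive: these points lie on the face [a = w]. *)
have q0' i : t i != 0 -> q i None = 0.
  move=> ti; have : \sum_i - (t i * q i None) = 0 by rewrite sumrN tq0 oppr0.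
  have pos k : true -> 0 <= - (t k * q k None).
    by rewrite oppr_ge0 mulr_ge0_le0// wt.1.
  move=> /(psumr_eq0P pos)/(_ i isT)/eqP.
  by rewrite oppr_eq0 mulf_eq0 (negbTE ti) => /eqP.
(* Only the coordinates in [I] are balanced here; [t't] ensures that the points kept are still on
   the face. Restriction to [A] makes the weights strictly positive. *)
have [t' [wt' t'I t't t'q]] := caratheodory (fun k i => q k (Some i)) wt.
pose A := finset (fun k => t' k != 0).
have sumA (g : _ -> R) : \sum_(k < #|A|) t' (enum_val k) * g (enum_val k) =
    \sum_k t' k * g k.
  rewrite -(big_enum_val (fun k => t' k * g k)) [RHS](bigID (mem A))/=.
  rewrite [X in _ = _ + X]big1 ?addr0// => k.
  by rewrite inE negbK => /eqP ->; rewrite mul0r.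
exists #|A|, (fun k => t' (enum_val k)), (fun k i => q (enum_val k) (Some i)).
split => //.
- by move=> k; rewrite lt_def wt'.1 andbT; have := enum_valP k; rewrite inE.
- have := sumA (fun=> 1); under eq_bigr do rewrite mulr1.
  by under [X in _ = X -> _]eq_bigr do rewrite mulr1; rewrite wt'.2.
- by move=> i; rewrite (sumA (fun k => q k (Some i))) t'q tq0.
- move=> k e e0; have [_ [a [p [Cap ->]]] pq] := qC (enum_val k) e e0.
  exists a, p; split=> // [|i]; last exact: (pq (Some i)).
  have := pq None; rewrite q0'/= ?subr0 ?ltr_norml => [/andP[+ _]|].
    by rewrite ltrBrDl.
  by apply: t't; have := enum_valP k; rewrite inE.
Qed.

(** * Scalar fields of finite real dimension *)

(* Lets R (d = 1) and R[i] (d = 2) be treated at once. *)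
Record real_coordinates (R : realType) (K : numFieldType) (d : nat) := {
  emb : {rmorphism R -> K};
  re : K -> R;
  rcoord : 'I_d -> K -> R;
  rbasis : 'I_d -> K;
  emb_ge0 : forall r, (0 <= emb r) = (0 <= r);
  ge0_embK : forall z, 0 <= z -> emb (re z) = z;
  re_emb : forall r, re (emb r) = r;
  reD : forall y z, re (y + z) = re y + re z;
  re_norm : forall z, emb `|re z| <= `|z|;
  sqr_dist_emb : forall z r,
    `|z - emb r| ^+ 2 = `|z| ^+ 2 + emb (r ^+ 2 - 2 * r * re z);
  rcoord_norm : forall e z, emb `|rcoord e z| <= `|z|;
  rcoord_basis : forall z, z = \sum_e emb (rcoord e z) * rbasis e;
  rcoord_functional : forall c : 'I_d -> R,
    exists k, forall z, re (k * z) = \sum_e c e * rcoord e z }.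

Lemma real_scalars (R : realType) : real_coordinates R R 1.
Proof.
apply: (@Build_real_coordinates R R 1 idfun id (fun=> id) (fun=> 1)) => //.
- by move=> z r /=; rewrite !real_normK ?num_real//; ring.
- by move=> z; rewrite big_ord1/= mulr1.
- by move=> c; exists (c 0) => z; rewrite big_ord1.
Qed.

Lemma complex_scalars (R : realType) : real_coordinates R R[i] 2.
Proof.
have Re_norm (z : R[i]) : (`|complex.Re z|%:C)%C <= `|z|.
  rewrite normc_def lecR -sqrtr_sqr ler_sqrt ?addr_ge0 ?sqr_ge0//.
  by rewrite lerDl sqr_ge0.
apply: (@Build_real_coordinates R R[i] 2 (real_complex R) (@complex.Re R)
  (fun e z => if e == 0 then complex.Re z else complex.Im z)
  (fun e => if e == 0 then 1 else 'i%C)) => //.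
- exact: ler0c.
- by move=> z z0; exact: RRe_real (ger0_real z0).
- by move=> [a b] [c e].
- move=> [a b] r; rewrite -!add_Re2_Im2/= -rmorphD; congr (_%:C)%C => /=.
  by rewrite subr0; ring.
- move=> e z; case: ifP => _; first exact: Re_norm.
  rewrite normc_def lecR -sqrtr_sqr ler_sqrt ?addr_ge0 ?sqr_ge0//.
  by rewrite lerDr sqr_ge0.
- move=> z; rewrite big_ord_recl big_ord1/= mulr1 {1}[z]complexE.
  by congr (_ + _); rewrite mulrC.
- move=> c; exists (c 0 -i* c 1)%C => -[a b].
  rewrite big_ord_recl big_ord1/= (_ : lift ord0 ord0 = 1)//=; last exact/val_inj.
  by simpc.
Qed.

Section RealCoordinates.
Context (R : realType) (K : numFieldType) (d : nat) (c : real_coordinates R K d).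
Local Notation emb := (emb c).
Local Notation re := (re c).
Local Notation rcoord := (rcoord c).
Local Notation rbasis := (rbasis c).

Lemma ler_emb r s : (emb r <= emb s) = (r <= s).
Proof. by rewrite -subr_ge0 -rmorphB emb_ge0 subr_ge0. Qed.

Lemma ltr_emb r s : (emb r < emb s) = (r < s).
Proof. by rewrite !lt_def ler_emb (inj_eq (fmorph_inj _)). Qed.

Lemma emb_gt0 r : (0 < emb r) = (0 < r).
Proof. by rewrite -(rmorph0 emb) ltr_emb. Qed.

Lemma norm_emb r : `|emb r| = emb `|r|.
Proof.
have [r0|r0] := ger0P r; first by rewrite ger0_norm// emb_ge0.
by rewrite ltr0_norm ?rmorphN// -oppr_gt0 -rmorphN emb_gt0 oppr_gt0.
Qed.

Lemma re_ge0 z : 0 <= z -> 0 <= re z.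
Proof. by move=> z0; rewrite -(emb_ge0 c) ge0_embK. Qed.

Lemma ler_re y z : 0 <= y -> y <= z -> re y <= re z.
Proof.
by move=> y0 yz; rewrite -ler_emb !ge0_embK// (le_trans y0).
Qed.

Lemma re0 : re 0 = 0.
Proof. by rewrite -(rmorph0 emb) re_emb. Qed.

Lemma re_sum (I : finType) (f : I -> K) : re (\sum_i f i) = \sum_i re (f i).
Proof. by apply: (big_morph re) => [y z|]; [exact: reD|exact: re0]. Qed.

(** Every positive element of [K] is the image of a positive real, so real radii suffice although
    the order of [K] may be partial. *)
Lemma cvg_embP (T : Type) (F : set_system T) (FF : Filter F) (g : T -> K^o) l :
  (forall e : R, 0 < e -> \forall k \near F, `|g k - l| < emb e) ->
  g k @[k --> F] --> (l : K^o).
Proof.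
move=> gl; apply/cvgrPdistC_lt => e e0.
have := gl (re e); rewrite ge0_embK ?ltW//; apply.
by rewrite -emb_gt0 ge0_embK// ltW.
Qed.

(** [supremum] selects a least upper bound if there is one. The image of the real supremum
    qualifies: an upper bound of [A] is nonnegative, hence comes from [R]. *)
Lemma supremum_ge0P (A : set K) (M : K) : A !=set0 ->
  (forall a, A a -> 0 <= a <= M) ->
  [/\ forall a, A a -> a <= supremum 0 A,
      forall N, (forall a, A a -> a <= N) -> supremum 0 A <= N &
      forall e, 0 < e -> exists2 a, A a & supremum 0 A - emb e < a].
Proof.
move=> [a0 Aa0] AM.
have A0 a : A a -> 0 <= a by move=> /AM/andP[].
pose S := [set re a | a in A].
have supS : has_sup S.
  split; first by exists (re a0), a0.
  exists (re M) => _ [a Aa <-]; apply: ler_re; first exact: A0.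
  by have /andP[] := AM _ Aa.
have lub : supremums A (emb (sup S)).
  split=> [a Aa|N NA].
    rewrite -(ge0_embK c (A0 _ Aa)) ler_emb; apply: sup_ubound => //.
      exact: supS.2.
    by exists a.
  have N0 : 0 <= N by rewrite (le_trans (A0 _ Aa0))// NA.
  rewrite -(ge0_embK c N0) ler_emb; apply: ge_sup; first exact: supS.1.
  by move=> _ [a Aa <-]; apply: ler_re; [exact: A0|exact: NA].
have -> : supremum 0 A = emb (sup S).
  rewrite /supremum ifF; last by apply/negP => /eqP A0'; rewrite A0' in Aa0.
  case: xgetP => [y yE yA|/(_ _ lub)//].
  exact: (is_subset1_supremums yA lub).
split; [exact: lub.1|by move=> N NA; apply: lub.2|].
move=> e e0; have [_ [a Aa <-] ae] := sup_adherent e0 supS.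
by exists a => //; rewrite -rmorphB -(ge0_embK c (A0 _ Aa)) ltr_emb.
Qed.

(** * States and the numerical radius *)

Section NumericalRadiusTheory.
Context (X : normedModType K).
Implicit Types (f : blinear X K^o) (x : X) (S T : blinear X X).

Lemma blinear_bound (G : normedModType K) (g : blinear X G) :
  exists M : K, forall x, `|g x| <= M * `|x|.
Proof. by have := blinearP g; rewrite inE => -[]. Qed.

Lemma blinear_linear (G : normedModType K) (g : blinear X G) : linear g.
Proof. by have := blinearP g; rewrite inE => -[]. Qed.

Lemma blinearZ (G : normedModType K) (g : blinear X G) a x :
  g (a *: x) = a *: g x.
Proof.
have g0 : g 0 = 0.
  have := blinear_linear g 1 0 0; rewrite !scale1r addr0 => /esym/eqP.
  by rewrite -subr_eq0 addrK => /eqP.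
by have := blinear_linear g a x 0; rewrite !addr0 g0 addr0.
Qed.

Lemma blinear0 (G : normedModType K) (g : blinear X G) : g 0 = 0.
Proof. by rewrite -(scale0r (0 : X)) blinearZ scale0r. Qed.

Lemma blinearD (G : normedModType K) (g : blinear X G) x y :
  g (x + y) = g x + g y.
Proof. by have := blinear_linear g 1 x y; rewrite !scale1r. Qed.

Lemma blinear_sum (G : normedModType K) (g : blinear X G) (I : finType)
    (y : I -> X) : g (\sum_i y i) = \sum_i g (y i).
Proof. by apply: (big_morph g); [exact: blinearD|exact: blinear0]. Qed.

Lemma sum_blinearE (G : normedModType K) (I : finType)
    (g : I -> blinear X G) x : (\sum_i g i) x = \sum_i g i x.
Proof. by apply: (big_morph (fun h : blinear X G => h x)). Qed.

Lemma dual_normP f :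
  [/\ forall x, `|x| <= 1 -> `|f x| <= dual_norm f,
      forall x, `|f x| <= dual_norm f * `|x| &
      forall N, (forall x, `|x| <= 1 -> `|f x| <= N) -> dual_norm f <= N].
Proof.
have [M fM] := blinear_bound f.
(* [M] need not be nonnegative when [X = 0], hence its norm as the bound. *)
have [||ub lub _] := @supremum_ge0P [set `|f x| | x in [set x : X | `|x| <= 1]] `|M|.
- by exists `|f 0|, 0 => //=; rewrite normr0.
- move=> _ [x /= x1 <-]; rewrite normr_ge0/=.
  rewrite (le_trans (real_ler_norm _))// ?normr_real//.
  rewrite (le_trans (y := `|M * `|x| |))//.
    rewrite normr_id (le_trans (fM x))// real_ler_norm// ger0_real//.
    exact: le_trans (fM x).
  by rewrite normrM normr_id ler_piMr.
have le1 x : `|x| <= 1 -> `|f x| <= dual_norm f by move=> x1; apply: ub; exists x.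
split=> //.
  move=> x; have [->|x0] := eqVneq x 0; first by rewrite blinear0 !normr0 mulr0.
  have nx : 0 < `|x| by rewrite normr_gt0.
  rewrite -ler_pdivrMr//.
  have := le1 (`|x|^-1 *: x); rewrite blinearZ !normrZ normfV normr_id mulVf ?gt_eqF//.
  by rewrite mulrC; apply.
by move=> N fN; apply: lub => _ [x /= x1 <-]; exact: fN.
Qed.

Lemma dual_norm_ge0 f : 0 <= dual_norm f.
Proof.
have [+ _ _] := dual_normP f => /(_ 0); rewrite normr0 ler01 => /(_ isT).
exact: le_trans.
Qed.

Lemma dual_normZ a f : dual_norm (a *: f) = `|a| * dual_norm f.
Proof.
have le_Z (b : K) (g : blinear X K^o) : dual_norm (b *: g) <= `|b| * dual_norm g.
  have [_ _] := dual_normP (b *: g); apply => x x1.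
  rewrite normrM ler_wpM2l//.
  by have [+ _ _] := dual_normP g; apply.
apply/le_anti; rewrite le_Z/=; have [->|a0] := eqVneq a 0.
  by rewrite normr0 mul0r dual_norm_ge0.
by rewrite mulrC -ler_pdivlMr ?normr_gt0// mulrC -normfV -{1}(scalerK a0 f) le_Z.
Qed.

Lemma numerical_radiusP T :
  [/\ forall f x, dual_norm f = 1 -> `|x| = 1 -> f x = 1 ->
        `|f (T x)| <= numerical_radius T,
      0 <= numerical_radius T &
      forall e, 0 < e -> exists f x,
        [/\ dual_norm f <= 1, `|x| <= 1, `|f x| = dual_norm f * `|x| &
            numerical_radius T - emb e < `|f (T x)|]].
Proof.
pose A := [set r : K | exists f x,
  [/\ dual_norm f = 1, `|x| = 1, f x = 1 & r = `|f (T x)|]].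
have [A0|/set0P A0] := eqVneq A set0.
  have w0 : numerical_radius T = 0.
    by rewrite /numerical_radius -/A A0 supremum0.
  rewrite w0; split=> // [f x f1 x1 fx|e e0].
    have : A `|f (T x)| by exists f, x.
    by rewrite A0.
  (* No state exists when X = 0; the pair (0, 0) still gives a member of calA. *)
  exists 0, 0; rewrite !normr0 sub0r oppr_lt0 emb_gt0.
  rewrite -(scale0r 0) dual_normZ normr0 !mul0r.
  by split.
have [M TM] := blinear_bound T.
have [|ub _ adh] := @supremum_ge0P A `|M| A0.
  move=> _ [f [x [f1 x1 fx ->]]]; rewrite normr_ge0/=.
  have [_ + _] := dual_normP f => /(_ (T x)); rewrite f1 mul1r => /le_trans; apply.
  have := TM x; rewrite x1 mulr1 => TxM.
  by rewrite (le_trans TxM)// real_ler_norm// ger0_real// (le_trans _ TxM).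
have wub f x : dual_norm f = 1 -> `|x| = 1 -> f x = 1 ->
    `|f (T x)| <= numerical_radius T.
  by move=> f1 x1 fx; apply: ub; exists f, x.
split=> // [|e e0].
  by have [_ [f [x [f1 x1 fx _]]]] := A0; apply: le_trans (wub _ _ f1 x1 fx).
have [_ [f [x [f1 x1 fx ->]]] ae] := adh e e0.
by exists f, x; rewrite f1 x1 fx normr1 mulr1; split.
Qed.

(** If [f] and [x] are nonzero, rescaling them to norm 1 with value 1 gives an exact state, whose
    value at [S] is [f (S x) / f x]; the denominator has modulus at most 1. *)
Lemma state_le f x S : dual_norm f <= 1 -> `|x| <= 1 ->
  `|f x| = dual_norm f * `|x| -> `|f (S x)| <= numerical_radius S.
Proof.
move=> f1 x1 fx; have [wub w0 _] := numerical_radiusP S.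
have [_ fle _] := dual_normP f.
have [f0|f0] := eqVneq (dual_norm f) 0.
  by have := fle (S x); rewrite f0 mul0r => /le_trans; apply.
have [->|x0] := eqVneq x 0; first by rewrite !blinear0 normr0.
have fx0 : f x != 0 by rewrite -normr_eq0 fx mulf_neq0// normr_eq0.
pose a := `|x| / f x.
have na : `|a| = (dual_norm f)^-1.
  by rewrite normf_div fx normr_id invfM mulrCA mulfV ?mulr1// normr_eq0.
have := wub (a *: f) (`|x|^-1 *: x); rewrite dual_normZ na mulVf// => /(_ erefl).
have -> : `|(`|x|^-1 *: x)| = 1.
  by rewrite normrZ normfV normr_id mulVf// normr_eq0.
move=> /(_ erefl).
have fE y : (a *: f) (`|x|^-1 *: y) = f y / f x.
  rewrite blinearZ -[LHS]/(`|x|^-1 * (a * f y)) /a mulrA mulrA mulVf ?normr_eq0//.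
  by rewrite mul1r mulrC.
rewrite fE divff// => /(_ erefl); rewrite blinearZ fE normf_div fx.
apply: le_trans; rewrite ler_pdivlMr ?mulr_gt0 ?normr_gt0// ?lt_def ?f0 ?dual_norm_ge0//.
by rewrite ler_piMr// mulr_ile1// dual_norm_ge0.
Qed.

(** A functional in [calA] may come from a pair other than [f], [x], hence [g] and [y]. Membership
    in [dual_w] follows from [state_le] with constant 1. *)
Lemma calA_tensorP f x :
  calA (tensor f x) <-> exists (g : blinear X K^o) (y : X),
    [/\ forall S, f (S x) = g (S y), dual_norm g <= 1, `|y| <= 1 & `|g y| = dual_norm g * `|y|].
Proof.
split=> [[_ [g [y [fg g1 y1 gy]]]]|[g [y [fg g1 y1 gy]]]].
  by exists g, y; split=> // S; have := congr1 (fun phi => phi S) fg.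
split; last first.
  by exists g, y; split=> //; apply/funext => S; exact: fg.
split; first by move=> a S S'; rewrite /tensor/= blinearD blinearZ.
by exists 1 => S; rewrite mul1r /tensor fg; exact: state_le.
Qed.

Lemma calA_le f x S : calA (tensor f x) -> `|f (S x)| <= numerical_radius S.
Proof. by move=> /calA_tensorP[g [y [-> g1 y1 gy]]]; exact: state_le. Qed.

(** Lets a modulus be turned into a real part without leaving [calA]. *)
Lemma calA_rotate u f x : `|u| = 1 -> calA (tensor f x) -> calA (tensor (u *: f) x).
Proof.
move=> u1 /calA_tensorP[g [y [fg g1 y1 gy]]]; apply/calA_tensorP.
exists (u *: g), y; rewrite dual_normZ u1 mul1r; split=> //.
  by move=> S /=; rewrite fctE/= fg.
by rewrite normrM u1 mul1r.
Qed.

Lemma calA_approx T e : 0 < e ->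
  exists f x, calA (tensor f x) /\ numerical_radius T - emb e < `|f (T x)|.
Proof.
move=> e0; have [_ _ /(_ e e0)[f [x [f1 x1 fx fT]]]] := numerical_radiusP T.
by exists f, x; split=> //; apply/calA_tensorP; exists f, x.
Qed.

End NumericalRadiusTheory.
End RealCoordinates.

(** * Orthogonality *)

Lemma cvg_norm_le (K : numFieldType) (V : normedModType K) (T : Type)
    (F : set_system T) (g : T -> V) (l : V) (N : K) : ProperFilter F ->
  g x @[x --> F] --> l -> (forall x, `|g x| <= N) -> `|l| <= N.
Proof.
move=> FF /cvgrPdist_lt gl gN; apply/ler_addgt0Pr => e e0.
have [x xe] := filter_ex (gl e e0).
by rewrite -[l](subrK (g x)) addrC (le_trans (ler_normD _ _))// lerD// ltW.
Qed.

(** Sequences suffice for the required nets: [V] is finite-dimensional, so only the values at [T]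
    and at a basis have to be made convergent. *)
Definition seq_net (T : Type) (u : nat -> T) : net T :=
  {| net_index := nat; net_le := fun m k => (m <= k)%N;
     net_inhabited := inhabits 0%N;
     net_refl := leqnn;
     net_trans := fun m k p mk kp => leq_trans mk kp;
     net_directed := fun m k =>
       ex_intro _ (maxn m k) (conj (leq_maxl m k) (leq_maxr m k));
     net_val := u |}.

Lemma cvg_seq_net (T : Type) (u : nat -> T) (V : topologicalType) (g : T -> V)
    (l : V) :
  g (u k) @[k --> \oo] --> l ->
  g (seq_net u a) @[a --> tails (seq_net u)] --> l.
Proof. by move=> H A /H[N _ NA]; exists N => k; exact: NA. Qed.

Section Orthogonality.
Context (R : realType) (K : numFieldType) (d : nat) (c : real_coordinates R K d).
Context (X : normedModType K) (V : set (blinear X X)) (T : blinear X X).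

(** Conditions (i) and (ii) over [K] without the bound on [h], so that each direction is proved once
    for both fields. *)
Definition limit_certificate (h : nat) (t : 'I_h -> K) : Prop :=
  [/\ forall i, 0 < t i, \sum_i t i = 1 &
    exists x : 'I_h -> net (blinear X K^o * X),
      [/\ forall i a, calA (tensor (x i a).1 (x i a).2),
          forall i, (x i a).1 (T (x i a).2) @[a --> tails (x i)]
                      --> (numerical_radius T : K^o) &
          forall S, V S ->
            (forall i, cvg ((x i a).1 (S (x i a).2) @[a --> tails (x i)])) /\
            \sum_i t i * lim ((x i a).1 (S (x i a).2) @[a --> tails (x i)])
              = 0]].

(** As the weighted mean of the [kap i] is 0, w(T) is the mean of the numbers w(T) + l [kap i]; each
    is a limit of values at [T + l *: A] of members of [calA], hence bounded by w(T + l A). *)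
Lemma certificate_orth h (t : 'I_h -> K) :
  limit_certificate t -> orth_w_subspace T V.
Proof.
move=> [t0 t1 [x [Ax xT xS]]] A VA l; have [Acvg Alim] := xS A VA.
pose kap i := lim ((x i a).1 (A (x i a).2) @[a --> tails (x i)]).
have {}Alim : \sum_i t i * kap i = 0 := Alim.
set N := numerical_radius (T + l *: A).
have wkap i : `|numerical_radius T + l * kap i| <= N.
  have kapP : (x i a).1 (A (x i a).2) @[a --> tails (x i)] --> kap i by exact: Acvg.
  have H : ((x i a).1 (T (x i a).2) + l * (x i a).1 (A (x i a).2) : K^o)
      @[a --> tails (x i)] --> (numerical_radius T + l * kap i : K^o).
    by apply: cvgD; [exact: xT|exact: cvgMl_tmp kapP].
  apply: (cvg_norm_le _ H) => a.
  have := calA_le c (T + l *: A) (Ax i a).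
  by rewrite blinearD blinearZ.
have [_ w0 _] := numerical_radiusP c T.
rewrite -(ger0_norm w0).
have -> : numerical_radius T = \sum_i t i * (numerical_radius T + l * kap i).
  under eq_bigr do rewrite mulrDr mulrCA.
  by rewrite big_split/= -mulr_suml t1 mul1r -mulr_sumr Alim mulr0 addr0.
rewrite (le_trans (ler_norm_sum _ _ _))// -[leRHS]mul1r -t1 mulr_suml.
by apply: ler_sum => i _; rewrite normrM (gtr0_norm (t0 i)) ler_pM2l.
Qed.

Lemma unimodular_rotation (z : K) : exists u : K, `|u| = 1 /\ u * z = `|z|.
Proof.
have [->|z0] := eqVneq z 0; first by exists 1; rewrite normr1 normr0 mulr0.
exists (`|z| / z); rewrite divfK// normf_div normr_id divff//.
by rewrite normr_eq0.
Qed.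

(** [extreme_convex_comb] is applied with the [n * d] real coordinates of the values at a basis,
    whence the bound on [h]. *)
Lemma orth_certificate n : subspace_of_dim n V -> orth_w_subspace T V ->
  exists (h : nat) (t : 'I_h -> K),
    (h <= (n * d).+1)%N /\ limit_certificate t.
Proof.
move=> [b [_ VE]] TV.
pose w := re c (numerical_radius T).
have wE (S : blinear X X) : emb c (re c (numerical_radius S)) = numerical_radius S.
  by rewrite ge0_embK//; have [] := numerical_radiusP c S.
pose C := [set aq : R * ('I_n * 'I_d -> R) | exists (f : blinear X K^o) (x : X),
  [/\ calA (tensor f x), aq.1 = re c (f (T x)) &
      aq.2 = fun je => rcoord c je.2 (f (b je.1 x))]].
pose M := \sum_j re c (numerical_radius (b j)).
have M0 j : 0 <= re c (numerical_radius (b j)).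
  by apply: re_ge0; have [] := numerical_radiusP c (b j).
have [|||h [t [q [hle t0 t1 tq qC]]]] := @extreme_convex_comb R _ C w M.
- move=> a q [f [x [/= fx -> _]]]; rewrite -(ler_emb c) wE.
  by rewrite (le_trans (re_norm _ _))// (calA_le c).
- move=> a q [j e] [f [x [/= fx _ ->]]] /=; rewrite -(ler_emb c).
  rewrite (le_trans (rcoord_norm _ _ _))// (le_trans (calA_le c _ fx))//.
  by rewrite -wE ler_emb /M (bigD1 j)//= lerDl sumr_ge0.
- move=> g e e0.
  (* The real functional with coefficients [g] is [re] of evaluation at some [S] in [V];
     orthogonality to [S] and a rotated near-maximal pair for [T + S] give the required point of
     [C]. *)
  have /choice[k kP] (j : 'I_n) := rcoord_functional c (fun e => g (j, e)).
  pose S := \sum_j k j *: b j.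
  have VS : V S by rewrite VE; exists k.
  have [f [x [fx fTS]]] := calA_approx c (T + 1 *: S) e0.
  have [u [u1 uE]] := unimodular_rotation (f ((T + 1 *: S) x)).
  pose f' := u *: f.
  exists (re c (f' (T x))), (fun je => rcoord c je.2 (f' (b je.1 x))).
  split; first by exists f', x; split=> //; exact: (calA_rotate c).
  have -> : \sum_je g je * rcoord c je.2 (f' (b je.1 x)) = re c (f' (S x)).
    rewrite sum_blinearE blinear_sum re_sum.
    rewrite (eq_bigr (fun j => \sum_e g (j, e) * rcoord c e (f' (b j x)))).
      by rewrite pair_bigA/=; apply: eq_bigr => -[].
    by move=> j _; rewrite -kP blinearZ.
  rewrite -reD -(ltr_emb c) rmorphB wE.
  have -> : f' (T x) + f' (S x) = `|f ((T + 1 *: S) x)|.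
    by rewrite -uE scale1r -blinearD.
  rewrite ge0_embK//; apply: le_lt_trans fTS; rewrite lerD2r.
  exact: TV.
exists h, (fun i => emb c (t i)); split.
  by rewrite (leq_trans hle)// card_prod !card_ord.
split.
- by move=> i; rewrite emb_gt0.
- by rewrite -rmorph_sum t1 rmorph1.
have /choice[fx fxP] (ik : 'I_h * nat) : exists fx : blinear X K^o * X,
    [/\ calA (tensor fx.1 fx.2),
        w - ik.2.+1%:R^-1 < re c (fx.1 (T fx.2)) &
        forall j e, `|rcoord c e (fx.1 (b j fx.2)) - q ik.1 (j, e)| < ik.2.+1%:R^-1].
  have [|a [p [[f [x [/= fx -> ->]]] wa pq]]] := qC ik.1 ik.2.+1%:R^-1.
    by rewrite invr_gt0.
  by exists (f, x); split=> // j e; exact: (pq (j, e)).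
pose kap i j : K^o := \sum_e emb c (q i (j, e)) * rbasis c e.
have kapP i j : (fx (i, k)).1 (b j (fx (i, k)).2) @[k --> \oo] --> kap i j.
  rewrite (_ : (fun k => _) = fun k => \sum_e
    (emb c (rcoord c e ((fx (i, k)).1 (b j (fx (i, k)).2))) * rbasis c e : K^o)); last first.
    by apply/funext => k; rewrite -rcoord_basis.
  apply: cvg_sum => e; apply: cvgMr_tmp; apply: (cvg_embP (c := c)) => eps eps0.
  have := near_infty_natSinv_lt (PosNum eps0); apply: filterS => k /=.
  have [_ _ /(_ j e)/= H] := fxP (i, k) => /(lt_trans H).
  by rewrite -rmorphB norm_emb ltr_emb.
have Tcvg i : (fx (i, k)).1 (T (fx (i, k)).2) @[k --> \oo] -->
    (numerical_radius T : K^o).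
  apply: (cvg_embP (c := c)) => e e0.
  have w0 : 0 <= w by apply: re_ge0; have [] := numerical_radiusP c T.
  (* For [z] of modulus at most [w] with [re z > w - s], the squared distance from [z] to [w] is at
     most [2 * w * s]. The summand 1 keeps the denominator positive when [w = 0]. *)
  have e1 : 0 < e ^+ 2 / (2 * w + 1) by rewrite divr_gt0 ?exprn_gt0//; lra.
  have := near_infty_natSinv_lt (PosNum e1); apply: filterS => k /=.
  have [fxA /= + _] := fxP (i, k).
  set z := (fx (i, k)).1 _; set s := k.+1%:R^-1 => ws se.
  have zw : `|z| <= emb c w by rewrite wE; exact: (calA_le c).
  rewrite -wE -/w -(@ltr_pXn2r _ 2)// ?nnegrE ?emb_ge0 ?(ltW e0)//.
  rewrite sqr_dist_emb.
  apply: (@le_lt_trans _ _ (emb c (w ^+ 2 + (w ^+ 2 - 2 * w * re c z)))).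
    by rewrite [leRHS]rmorphD lerD2r rmorphXn ler_pXn2r// nnegrE ?emb_ge0//.
  rewrite -rmorphXn ltr_emb.
  rewrite ltr_pdivlMr in se; last by lra.
  have s0 : 0 < s by rewrite invr_gt0.
  by nra.
exists (fun i => seq_net (fun k => fx (i, k))); split.
- by move=> i k; have [] := fxP (i, k).
- move=> i; exact: (@cvg_seq_net _ (fun k => fx (i, k)) K^o
    (fun fx => fx.1 (T fx.2)) _ (Tcvg i)).
- move=> S; rewrite VE => -[s _ <-].
  pose S' := \sum_j s j *: b j.
  have Scvg i : (seq_net (fun k => fx (i, k)) a).1 (S' (seq_net (fun k => fx (i, k)) a).2)
      @[a --> tails (seq_net (fun k => fx (i, k)))] --> \sum_j s j * kap i j.
    apply: (@cvg_seq_net _ (fun k => fx (i, k)) K^o (fun fx => fx.1 (S' fx.2))).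
    rewrite (_ : (fun k => _) = fun k => \sum_j
      (s j * (fx (i, k)).1 (b j (fx (i, k)).2) : K^o)); last first.
      apply/funext => k; rewrite sum_blinearE blinear_sum.
      by apply: eq_bigr => j _; rewrite blinearZ.
    by apply: cvg_sum => j; apply: cvgMl_tmp; exact: kapP.
  split=> [i|]; first by apply/cvg_ex; exists (\sum_j s j * kap i j); exact: Scvg.
  rewrite (eq_bigr (fun i => emb c (t i) * \sum_j s j * kap i j)); last first.
    by move=> i _; congr (_ * _); apply: cvg_lim; [exact: norm_hausdorff|exact: Scvg].
  (* After exchanging the sums, the inner coefficients are [\sum_i t i * q i (j, e)], which vanish
     by [tq]. *)
  under eq_bigr do rewrite mulr_sumr.
  rewrite exchange_big/= big1// => j _.
  under eq_bigr do rewrite mulrCA.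
  rewrite -mulr_sumr /kap; under eq_bigr do rewrite mulr_sumr.
  rewrite exchange_big/= big1 ?mulr0// => e _.
  under eq_bigr do rewrite mulrA -rmorphM.
  by rewrite -mulr_suml -rmorph_sum tq rmorph0 mul0r.
Qed.

End Orthogonality.

Theorem theorem3p4 (R : realType) (s : scalars)
    (X : completeNormedModType (scalar_field R s))
    (w_norm : @numerical_radius_is_norm (scalar_field R s) X)
    (n : nat) (V : set (blinear X X)) (dimV : subspace_of_dim n V)
    (T : blinear X X) :
  orth_w_subspace T V <->
  exists (h : nat) (t : 'I_h -> scalar_field R s),
    [/\ (h <= max_terms s n)%N,
        forall i, 0 < t i,
        \sum_i t i = 1 &
        exists x : 'I_h -> net (blinear X (scalar_field R s)^o * X),
          [/\ forall i a, calA (tensor (x i a).1 (x i a).2),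
              forall i, (x i a).1 (T (x i a).2) @[a --> tails (x i)]
                          --> (numerical_radius T : (scalar_field R s)^o) &
              forall S, V S ->
                (forall i, cvg ((x i a).1 (S (x i a).2) @[a --> tails (x i)])) /\
                \sum_i t i * lim ((x i a).1 (S (x i a).2) @[a --> tails (x i)])
                  = 0]].
Proof.
(* With [d = 1] over the reals and [d = 2] over the complex numbers, [(n * d).+1] becomes
   [max_terms s n]. *)
case: s X w_norm V dimV T => X _ V dimV T.
  split=> [TV|[h [t [_ t0 t1 tx]]]].
    have [h [t [hn [t0 t1 tx]]]] := orth_certificate (real_scalars R) dimV TV.
    by exists h, t; split; rewrite // /max_terms -[n]muln1.
  exact: (certificate_orth (real_scalars R) (And3 t0 t1 tx)).
split=> [TV|[h [t [_ t0 t1 tx]]]].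
  have [h [t [hn [t0 t1 tx]]]] := orth_certificate (complex_scalars R) dimV TV.
  by exists h, t; split; rewrite // /max_terms -muln2.
exact: (certificate_orth (complex_scalars R) (And3 t0 t1 tx)).
Qed.
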